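(* Let $n\ge 2$, $\alpha>0$, $K\ge\frac{2^{3+\alpha}}{\alpha}$. Suppose $\vec m\in\mathbb{R}_+^n$ and $(\vec m,\vec\theta_{\vec m})\in\mathcal{CC}_0$. Then for every $g\in G$: (1) $g\cdot(\vec m,\vec\theta_{\vec m})=(g\vec m,\hat g\vec\theta_{\vec m})\in\mathcal{CC}_0$; (2) $f_K(\vec m,\vec\theta_{\vec m})=f_K(g\vec m,\hat g\vec\theta_{\vec m})\le f_K(g\vec m,\vec\theta_{\vec m})$ and $\hat g\vec\theta_{\vec m}=\vec\theta_{g\vec m}$; (3) if $\vec m=g\vec m$, then $\vec\theta_{\vec m}=\hat g\vec\theta_{\vec m}$.
   Context: $\mathbb{R}_+^n$ is the set of vectors with positive entries. For $\vec\theta\in\mathbb{R}^n$ with the points $e^{\sqrt{-1}\theta_1},\dots,e^{\sqrt{-1}\theta_n}$ pairwise distinct, put $r_{jk}(\vec\theta)=|2\sin\frac{\theta_j-\theta_k}{2}|$, and for $\vec m\in\mathbb{R}^n$ put $$U_\alpha(\vec m,\vec\theta)=\sum_{j<k}\frac{m_jm_k}{r_{jk}^\alpha(\vec\theta)},\quad U_{-2}(\vec m,\vec\theta)=\sum_{j<k}m_jm_kr_{jk}^2(\vec\theta),\quad f_K(\vec m,\vec\theta)=U_\alpha(\vec m,\vec\theta)+\frac{1}{K}U_{-2}(\vec m,\vec\theta).$$ Let $\mathcal{K}_0=\{\vec\theta\in\mathbb{R}^n: 0<\theta_1<\theta_2<\dots<\theta_n=2\pi\}$, $M=\sum_k m_k$,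 $\vec 1=(1,\dots,1)^T$. $\mathcal{CC}_0$ is the set of pairs $(\vec m,\vec\theta)\in\mathbb{R}_+^n\times\mathcal{K}_0$ satisfying $$\nabla_{\vec\theta}U_\alpha=\vec0,\quad \nabla_{\vec m}U_\alpha=\frac{2U_\alpha}{M}\vec 1,\quad \nabla_{\vec\theta}U_{-2}=\vec0,\quad \nabla_{\vec m}U_{-2}=2M\vec1$$ at $(\vec m,\vec\theta)$, i.e. the masses $m_j$ at $e^{\sqrt{-1}\theta_j}$ form a central configuration on the unit circle whose center of mass is the center of the circle. For each $\vec m\in\mathbb{R}_+^n$ there is a unique point $\vec\theta_{\vec m}\in\mathcal{K}_0$ with $\nabla_{\vec\theta}f_K(\vec m,\vec\theta_{\vec m})=\vec0$; it is the unique minimum of $f_K(\vec m,\cdot)$ on $\mathcal{K}_0$. Let $P,S$ be the $n\times n$ permutation matrices given by $(P\vec v)_k=v_{k+1}$ for $k<n$, $(P\vec v)_n=v_1$, and $(S\vec v)_k=v_{n-k}$ for $k<n$, $(S\vec v)_n=v_n$. Let $G=\langle P,S\rangle$ be the dihedral group they generate. Let $\mathcal{P},\mathcal{S}$ be the $n\times n$ matrices given by $(\mathcal{P}\vec v)_k=v_{k+1}-v_1$ for $k<n$, $(\mathcal{P}\vec v)_n=v_n$, and $(\mathcal{S}\vec v)_k=v_n-v_{n-k}$ for $k<n$, $(\mathcal{S}\vec v)_n=v_n$; these preserve $\mathcal{K}_0$. For $g=P^hS^l\in G$ put $\hat g=\mathcal{P}^h\mathcal{S}^l$, and $g\cdot(\vec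 m,\vec\theta)=(g\vec m,\hat g\vec\theta)$. *)

(* Defs.v *)
From HB Require Import structures.
From mathcomp Require Import all_boot all_order all_algebra.
From mathcomp Require Import all_classical all_reals all_analysis.
From mathcomp Require Import zify.

Set Implicit Arguments.
Unset Strict Implicit.
Unset Printing Implicit Defensive.

Import Order.TTheory GRing.Theory Num.Theory.
Import numFieldNormedType.Exports.

Local Open Scope classical_set_scope.
Local Open Scope ring_scope.

(* Indices are zero-based: the coordinate v_k of the mathematical text, with
   1 <= k <= n, is the entry of v : 'cV[R]_n in the row of value k - 1. *)

Definition pos_vec (R : realType) (n : nat) (m : 'cV[R]_n) : Prop :=
  forall j, 0 < m j 0.

Definition total_mass (R : realType) (n : nat) (m : 'cV[R]_n) : R :=
  \sum_k m k 0.

Definition gradient (R : realType) (n : nat) (f : 'cV[R]_n -> R)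
    (x : 'cV[R]_n) : 'cV[R]_n :=
  \col_j 'D_(delta_mx j 0) f x.

Definition dist (R : realType) (n : nat) (theta : 'cV[R]_n) (j k : 'I_n) : R :=
  `|2 * sin ((theta j 0 - theta k 0) / 2)|.

Definition U (R : realType) (n : nat) (alpha : R) (m theta : 'cV[R]_n) : R :=
  \sum_(j < n) \sum_(k < n | (j < k)%N)
    m j 0 * m k 0 / dist theta j k `^ alpha.

Definition Um2 (R : realType) (n : nat) (m theta : 'cV[R]_n) : R :=
  \sum_(j < n) \sum_(k < n | (j < k)%N) m j 0 * m k 0 * dist theta j k ^+ 2.

Definition fK (R : realType) (n : nat) (alpha K : R) (m theta : 'cV[R]_n) : R :=
  U alpha m theta + K^-1 * Um2 m theta.

Definition K0 (R : realType) (n : nat) : set 'cV[R]_n :=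
  [set theta | [/\ forall j, 0 < theta j 0,
                   forall j k : 'I_n, (j < k)%N -> theta j 0 < theta k 0 &
                   forall j : 'I_n, j.+1 = n -> theta j 0 = 2 * pi]].

Definition CC0 (R : realType) (n : nat) (alpha : R) :
    set ('cV[R]_n * 'cV[R]_n) :=
  [set p | let: (m, theta) := p in
    (pos_vec m /\ K0 theta) /\
    [/\ gradient (fun t => U alpha m t) theta = 0,
        gradient (fun u => U alpha u theta) m
          = const_mx (2 * U alpha m theta / total_mass m),
        gradient (fun t => Um2 m t) theta = 0 &
        gradient (fun u => Um2 u theta) m = const_mx (2 * total_mass m)]].

(* The critical point of fK alpha K m on K0, which exists and is unique when m
   is positive, 0 < alpha and 2 `^ (3 + alpha) / alpha <= K. The default value
   0 is not in K0 (for 0 < n). *)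
Definition theta_of (R : realType) (n : nat) (alpha K : R) (m : 'cV[R]_n) :
    'cV[R]_n :=
  xget 0 [set theta | K0 theta /\ gradient (fun t => fK alpha K m t) theta = 0].

Definition P_mx (R : realType) (n : nat) : 'M[R]_n :=
  \matrix_(i, j) (j == (if (i.+1 < n)%N then i.+1 else 0%N) :> nat)%:R.

Definition S_mx (R : realType) (n : nat) : 'M[R]_n :=
  \matrix_(i, j) (j == (if (i.+1 < n)%N then n - i.+2 else i)%N :> nat)%:R.

Definition Phat_mx (R : realType) (n : nat) : 'M[R]_n :=
  \matrix_(i, j) if (i.+1 < n)%N then (j == i.+1 :> nat)%:R - (j == 0%N :> nat)%:R
                 else (j == i)%:R.

Definition Shat_mx (R : realType) (n : nat) : 'M[R]_n :=
  \matrix_(i, j) if (i.+1 < n)%N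
                 then (j.+1 == n)%:R - (j == (n - i.+2)%N :> nat)%:R
                 else (j == i)%:R.

(* The subgroup of GL_n(R) generated by P_mx and S_mx. *)
Inductive dihedral (R : realType) (n : nat) : 'M[R]_n -> Prop :=
| dihedral1 : dihedral 1%:M
| dihedralP : dihedral (P_mx R n)
| dihedralS : dihedral (S_mx R n)
| dihedralM g h : dihedral g -> dihedral h -> dihedral (g *m h)
| dihedralV g : dihedral g -> dihedral (invmx g).

(* For n = 2 the matrix S_mx is the identity while Shat_mx is not, so that the
   matrix below depends on the exponents and not only on P_mx ^+ h *m S_mx ^+ l. *)
Definition hat_mx (R : realType) (n : nat) (h l : nat) : 'M[R]_n :=
  Phat_mx R n ^+ h *m Shat_mx R n ^+ l.

Section NormalForm.
Variables (R : realType) (n : nat).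

Let mul_sel p (X : 'M[R]_(n, p)) (s : 'I_n -> 'I_n) i j :
  (\matrix_(a, b) (b == s a :> nat)%:R *m X) i j = X (s i) j.
Proof.
rewrite mxE (bigD1 (s i)) //= mxE eqxx mul1r big1 ?addr0 // => k /negbTE ks.
by rewrite mxE (_ : (k == s i :> nat) = false) ?mul0r.
Qed.

Let sS_subproof (i : 'I_n) : ((if i.+1 < n then n - i.+2 else i) < n)%N.
Proof. by have := ltn_ord i; case: ifP; lia. Qed.
Let sS i := Ordinal (sS_subproof i).

Let PE p (X : 'M[R]_(n, p)) i j : (P_mx R n *m X) i j = X (ordS i) j.
Proof.
rewrite -(mul_sel X (@ordS n)); congr ((_ *m _) _ _).
apply/matrixP => a b; rewrite !mxE /=.
have := ltn_ord a; case: ifP => H ?; first by rewrite modn_small.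
by rewrite (_ : a.+1 = n) ?modnn //; lia.
Qed.

Let SE p (X : 'M[R]_(n, p)) i j : (S_mx R n *m X) i j = X (sS i) j.
Proof. exact: (mul_sel X sS). Qed.

Let PnE : P_mx R n ^+ n = 1%:M.
Proof.
have H k p (X : 'M[R]_(n, p)) i j :
    (P_mx R n ^+ k *m X) i j = X (iter k (@ordS n) i) j.
  elim: k i => [|k IH] i; first by rewrite expr0 mul1mx.
  by rewrite exprS -mulmxA PE IH iterSr.
have I k (i : 'I_n) : iter k (@ordS n) i = ((i + k) %% n)%N :> nat.
  elim: k => [|k IH]; first by rewrite addn0 modn_small.
  by rewrite iterS /= IH -addn1 modnDml addn1 addnS.
apply/matrixP => i j; rewrite -[P_mx R n ^+ n]mulmx1 H; congr (_ _ _).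
by apply/val_inj; rewrite /= I modnDr modn_small.
Qed.

Let SSE : S_mx R n *m S_mx R n = 1%:M.
Proof.
apply/matrixP => i j; rewrite -[S_mx R n in X in _ *m X]mulmx1 !SE.
congr (_ _ _); apply/val_inj => /=; have := ltn_ord i.
by case: (ltnP i.+1 n) => ? ?; case: ifP; lia.
Qed.

Let PSPE : P_mx R n *m S_mx R n *m P_mx R n = S_mx R n.
Proof.
apply/matrixP => i j; rewrite -!mulmxA PE SE -[P_mx R n]mulmx1 PE.
rewrite -[in RHS](mulmx1 (S_mx R n)) SE; congr (_ _ _); apply/val_inj => /=.
have := ltn_ord i; case: (ltnP i.+1 n) => H ?.
  rewrite (modn_small H); case: ifP => H'; first by rewrite modn_small; lia.
  have -> : i.+2 = n by lia.
  by rewrite modnn; lia.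
have -> : i.+1 = n by lia.
rewrite modnn; case: ifP => ?; first by rewrite modn_small; lia.
by rewrite (_ : 1 %% n = 0)%N; [lia | rewrite (_ : n = 1)%N ?modnn; lia].
Qed.

Lemma dihedral_normal_form (g : 'M[R]_n) : dihedral g ->
  exists h l, g = P_mx R n ^+ h *m S_mx R n ^+ l.
Proof.
pose P := P_mx R n; pose S := S_mx R n.
pose N (x : 'M[R]_n) := exists h l, x = P ^+ h *m S ^+ l.
have NM h l x : N x -> N (P ^+ h *m S ^+ l *m x).
  have NP y : N y -> N (P *m y).
    by case=> a [b ->]; exists a.+1, b; rewrite exprS mulmxA.
  have SP a : S *m P ^+ a = P ^+ (a * n.-1) *m S.
    case: (posnP n) => [n0|n_gt0].
      by apply/matrixP => i; have := ltn_ord i; rewrite [X in (_ < X)%N]n0.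
    have SP1 : S *m P = P ^+ n.-1 *m S.
      have PP k : P ^+ k *m P = P ^+ k.+1 by rewrite exprSr.
      by rewrite -[S in RHS]PSPE -!mulmxA [RHS]mulmxA PP prednK // PnE mul1mx.
    elim: a => [|a IH]; first by rewrite mul0n !expr0 mulmx1 mul1mx.
    by rewrite exprS mulmxA SP1 -mulmxA IH mulmxA mulSn exprD.
  have NS y : N y -> N (S *m y).
    case=> a [b ->]; exists (a * n.-1)%N, b.+1.
    by rewrite mulmxA SP -mulmxA exprS.
  move=> Nx; elim: h => [|h IH].
    rewrite expr0 mul1mx; elim: l => [|l IH]; first by rewrite expr0 mul1mx.
    by rewrite exprS -mulmxA; apply: NS.
  by rewrite exprS -!mulmxA; apply: NP; rewrite mulmxA.
have N1 : N 1%:M by exists 0%N, 0%N; rewrite !expr0 mulmx1.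
have Nmul x y : N x -> N y -> N (x *m y) by case=> h [l ->] /NM.
have NXP k : N (P ^+ k) by exists k, 0%N; rewrite expr0 mulmx1.
have NXS k : N (S ^+ k) by exists 0%N, k; rewrite expr0 mul1mx.
have NV h l : exists2 y, N y & y *m (P ^+ h *m S ^+ l) = 1%:M.
  exists (S ^+ l *m P ^+ (h * n.-1)); first exact: Nmul.
  case: (posnP n) => [n0|n_gt0].
    by apply/matrixP => i; have := ltn_ord i; rewrite [X in (_ < X)%N]n0.
  have PP a b : P ^+ a *m P ^+ b = P ^+ (a + b) by rewrite exprD.
  have SS a : S ^+ a *m S ^+ a = (S *m S) ^+ a by rewrite exprMn_comm.
  rewrite mulmxA -[S ^+ l *m _ *m _]mulmxA PP addnC -mulnS prednK //.
  by rewrite mulnC exprM PnE expr1n mulmx1 SS SSE expr1n.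
elim=> [||| |x _ [h [l ->]]]; first exact: N1.
- by exists 1%N, 0%N; rewrite expr1 expr0 mulmx1.
- by exists 0%N, 1%N; rewrite expr1 expr0 mul1mx.
- by move=> x y _ Nx _ Ny; apply: Nmul.
have [y Ny yx] := NV h l.
by have [_ ux] := mulmx1_unit yx; rewrite -(mulmxK ux y) yx mul1mx in Ny.
Qed.

End NormalForm.

(* Main.v *)
Require Import Defs.
From HB Require Import structures.
From mathcomp Require Import all_boot all_order all_algebra.
From mathcomp Require Import all_classical all_reals all_analysis.
From mathcomp Require Import ring lra zify.

Set Implicit Arguments.
Unset Strict Implicit.
Unset Printing Implicit Defensive.

Import Order.TTheory GRing.Theory Num.Theory.
Import numFieldNormedType.Exports.

Local Open Scope ring_scope.

(* With x = theta_k - theta_j in (0, 2 pi) and r = 2 sin (x / 2), f_K(m, .) is a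
   sum of terms m_j m_k phi(x) with
   phi' = - cos (x / 2) (alpha r^(- alpha - 1) - 2 r / K).
   On (0, pi] both factors of the product decrease and are nonnegative, the
   second one by the lower bound on K, and phi' is odd about pi; so phi' is
   strictly increasing, and a critical point on the convex set K0 is the unique
   minimum. A pair (g, g-hat) acts as a rotation or reflection of the circle
   followed by a relabelling of the points, so it preserves the energies and
   transports their gradients; hence g-hat theta_m is critical for g m. *)

(** * Chord lengths and the one-variable potentials *)

Definition chord (R : realType) (x : R) : R := 2 * sin (x / 2).

Lemma sin_half_gt0 (R : realType) (x : R) :
  0 < x < 2 * pi -> 0 < sin (x / 2).
Proof. by move=> /andP[x0 x2]; apply: sin_gt0_pi; apply/andP; split; lra. Qed.

Lemma chord_gt0 (R : realType) (x : R) : 0 < x < 2 * pi -> 0 < chord x.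
Proof. by move=> /sin_half_gt0 ?; rewrite /chord; lra. Qed.

Lemma is_derive_chord (R : realType) (x : R) :
  is_derive x 1 (@chord R) (cos (x / 2)).
Proof.
rewrite /chord; apply: is_derive_eq.
by rewrite !(mulr0, add0r, addr0, scaler0) /GRing.scale /=; field.
Qed.

Lemma chord_reflect (R : realType) (x : R) : chord (2 * pi - x) = chord x.
Proof.
rewrite /chord (_ : (2 * pi - x) / 2 = - (x / 2) + pi); last by field.
by rewrite sinDpi sinN opprK.
Qed.

(** The absolute value makes the potential even and [2 * pi]-periodic, as the symmetry argument
    requires. The derivative is written without it, since it is taken only where [chord x] is
    positive. *)
Definition power_potential (R : realType) (beta x : R) : R :=
  `|chord x| `^ beta.

Definition dpower_potential (R : realType) (beta x : R) : R :=
  cos (x / 2) * (beta * chord x `^ (beta - 1)).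

Lemma is_derive_power_potential (R : realType) (beta x : R) :
  0 < x < 2 * pi ->
  is_derive x 1 (power_potential beta) (dpower_potential beta x).
Proof.
move=> x_in; have c_gt0 := chord_gt0 x_in; have dc := is_derive_chord x.
apply: (@near_eq_is_derive R R R ((@powR R ^~ beta) \o @chord R)).
  have x_itv : x \in `]0, 2 * pi[ by rewrite in_itv.
  near=> y; have y_itv : y \in `]0, 2 * pi[ by near: y; exact: near_in_itvoo.
  by rewrite /power_potential /= ger0_norm // ltW // chord_gt0.
have dp := is_derive1_powR beta c_gt0.
rewrite /dpower_potential mulrC.
exact: (@is_derive1_comp R (@powR R ^~ beta) (@chord R)).
Unshelve. all: by end_near. Qed.

Lemma dpower_potential_reflect (R : realType) (beta x : R) :
  dpower_potential beta (2 * pi - x) = - dpower_potential beta x.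
Proof.
rewrite /dpower_potential chord_reflect (_ : (2 * pi - x) / 2 = - (x / 2) + pi).
  by rewrite cosDpi cosN mulNr.
by field.
Qed.

Definition mix_potential (R : realType) (alpha K x : R) : R :=
  power_potential (- alpha) x + K^-1 * power_potential 2 x.

Definition dmix_potential (R : realType) (alpha K x : R) : R :=
  dpower_potential (- alpha) x + K^-1 * dpower_potential 2 x.

Lemma is_derive_mix_potential (R : realType) (alpha K x : R) :
  0 < x < 2 * pi ->
  is_derive x 1 (mix_potential alpha K) (dmix_potential alpha K x).
Proof.
move=> x_in; have d1 := is_derive_power_potential (- alpha) x_in.
have d2 := is_derive_power_potential 2 x_in.
by rewrite /mix_potential; apply: is_derive_eq.
Qed.

Lemma cos_half_decr (R : realType) (x y : R) :
  0 <= x -> x < y -> y <= 2 * pi -> cos (y / 2) < cos (x / 2).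
Proof.
move=> x0 xy y2; rewrite ltr_cos ?in_itv /=; first lra.
  by apply/andP; split; lra.
by apply/andP; split; lra.
Qed.

Lemma chord_incr (R : realType) (x y : R) :
  0 <= x -> x < y -> y <= pi -> chord x < chord y.
Proof.
move=> x0 xy y2; rewrite /chord ltr_pM2l // ltr_sin ?in_itv /=; first lra.
  by apply/andP; split; lra.
by apply/andP; split; lra.
Qed.

(* The threshold on K says exactly that this is nonnegative at the longest
   chord, r = 2. *)
Definition pull (R : realType) (alpha K r : R) : R :=
  alpha * r `^ (- alpha - 1) - K^-1 * (2 * r).

Lemma dmix_potentialE (R : realType) (alpha K x : R) : 0 < chord x ->
  dmix_potential alpha K x = - (cos (x / 2) * pull alpha K (chord x)).
Proof.
move=> c_gt0; rewrite /dmix_potential /dpower_potential /pull.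
by rewrite (_ : 2 - 1 = 1 :> R) ?powRr1 ?ltW //; ring.
Qed.

Lemma pull_decr (R : realType) (alpha K r s : R) :
  0 < alpha -> 0 < K -> 0 < r -> r < s -> pull alpha K s < pull alpha K r.
Proof.
move=> a0 K0 r0 rs; have s0 := lt_trans r0 rs.
have e : - alpha - 1 = - (alpha + 1) by ring.
have a1 : 0 < alpha + 1 by lra.
have : alpha * s `^ (- alpha - 1) < alpha * r `^ (- alpha - 1).
  rewrite ltr_pM2l // e !powRN ltf_pV2 ?posrE ?powR_gt0 //.
  by rewrite gt0_ltr_powR // nnegrE ltW.
have : K^-1 * (2 * r) <= K^-1 * (2 * s) by rewrite ler_pM2l ?invr_gt0 //; lra.
rewrite /pull; lra.
Qed.

Lemma pull2_ge0 (R : realType) (alpha K : R) :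
  0 < alpha -> 2 `^ (3 + alpha) / alpha <= K -> 0 <= pull alpha K 2.
Proof.
move=> a0 hK; rewrite /pull.
have p0 : 0 < 2 `^ alpha :> R by rewrite powR_gt0.
have K0 : 0 < K by apply: lt_le_trans hK; rewrite divr_gt0 ?powR_gt0.
(* With [p = 2 ^ alpha], the bound on [K] and the goal [4 / K <= alpha / (2 p)] both become
   [8 p <= alpha K]. *)
have e1 : 2 `^ (3 + alpha) = 8 * 2 `^ alpha :> R.
  by rewrite powRD ?pnatr_eq0 ?implybT // (powR_mulrn 3) //; congr (_ * _); ring.
have e2 : 2 `^ (- alpha - 1) = (2 * 2 `^ alpha)^-1 :> R.
  rewrite (_ : - alpha - 1 = - (1 + alpha)) ?powRN; last by ring.
  by rewrite powRD ?pnatr_eq0 ?implybT // powRr1.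
rewrite e2 subr_ge0 mulrC ler_pdivrMr //.
move: hK; rewrite e1 ler_pdivrMr // => hK.
rewrite mulrAC ler_pdivlMr ?mulr_gt0 //.
by nra.
Qed.

Lemma pull_ge0 (R : realType) (alpha K r : R) :
  0 < alpha -> 2 `^ (3 + alpha) / alpha <= K -> 0 < r <= 2 ->
  0 <= pull alpha K r.
Proof.
move=> a0 hK /andP[r0 r2]; apply: le_trans (pull2_ge0 a0 hK) _.
have K0 : 0 < K by apply: lt_le_trans hK; rewrite divr_gt0 ?powR_gt0.
by move: r2; rewrite le_eqVlt => /predU1P[->//|/(pull_decr a0 K0 r0)/ltW].
Qed.

Lemma dmix_potential_incr_pi (R : realType) (alpha K x y : R) :
  0 < alpha -> 2 `^ (3 + alpha) / alpha <= K -> 0 < x -> x < y -> y <= pi ->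
  dmix_potential alpha K x < dmix_potential alpha K y.
Proof.
move=> a0 hK x0 xy ypi; have pi0 := pi_gt0 R.
have K0 : 0 < K by apply: lt_le_trans hK; rewrite divr_gt0 ?powR_gt0.
have cx : 0 < chord x by apply: chord_gt0; apply/andP; split; lra.
have cy : 0 < chord y by apply: chord_gt0; apply/andP; split; lra.
have cy2 : chord y <= 2 by rewrite /chord; have := sin_le1 (y / 2); lra.
rewrite !dmix_potentialE // ltrN2.
have cos_lt := cos_half_decr (ltW x0) xy ltac:(lra).
(* At [y = pi] this cosine vanishes, and so does the pull when [K] is the threshold. Weak
   nonnegativity of the two smaller factors still makes the products strictly ordered. *)
have cos_y : 0 <= cos (y / 2) by apply: cos_ge0_pihalf; apply/andP; split; lra.
have p_lt := pull_decr a0 K0 cx (chord_incr (ltW x0) xy ypi).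
have p_y := pull_ge0 a0 hK (introT andP (conj cy cy2)).
by apply: ltr_pM.
Qed.

(** The reflection about [pi] carries the second half of the interval to the first and changes the
    sign of the derivative. Points on opposite sides of [pi] are compared through [pi] itself. *)
Lemma dmix_potential_incr (R : realType) (alpha K x y : R) :
  0 < alpha -> 2 `^ (3 + alpha) / alpha <= K -> 0 < x -> x < y -> y < 2 * pi ->
  dmix_potential alpha K x < dmix_potential alpha K y.
Proof.
move=> a0 hK x0 xy y2; have pi0 := pi_gt0 R.
have refl z : dmix_potential alpha K (2 * pi - z) = - dmix_potential alpha K z.
  by rewrite /dmix_potential !dpower_potential_reflect mulrN opprD.
have incr_hi u v : pi <= u -> u < v -> v < 2 * pi ->
    dmix_potential alpha K u < dmix_potential alpha K v.
  move=> pu uv v2; rewrite -ltrN2 -!refl.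
  by apply: dmix_potential_incr_pi => //; lra.
have [y_le|pi_lt] := leP y pi; first exact: dmix_potential_incr_pi.
have [/incr_hi->//|x_lt] := leP pi x.
apply: lt_trans (dmix_potential_incr_pi a0 hK x0 x_lt (lexx _)) _.
exact: incr_hi.
Qed.

(** * Pair energies: directional derivatives and behaviour along segments *)

Definition pair_energy (R : realType) (n : nat) (phi : R -> R)
    (m theta : 'cV[R]_n) : R :=
  \sum_(j < n) \sum_(k < n | (j < k)%N)
    m j 0 * m k 0 * phi (theta k 0 - theta j 0).

Definition dpair_energy (R : realType) (n : nat) (dphi : R -> R)
    (m theta v : 'cV[R]_n) : R :=
  \sum_(j < n) \sum_(k < n | (j < k)%N)
    m j 0 * m k 0 * ((v k 0 - v j 0) * dphi (theta k 0 - theta j 0)).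

Lemma is_derive_sum_cond (R : realType) (n : nat) (p : pred 'I_n)
    (f : 'I_n -> R -> R) (df : 'I_n -> R) (t : R) :
  (forall i, p i -> is_derive t 1 (f i) (df i)) ->
  is_derive t 1 (fun s => \sum_(i | p i) f i s) (\sum_(i | p i) df i).
Proof.
move=> H; rewrite (_ : (fun s => _) = \sum_i (if p i then f i else 0)).
  rewrite [X in is_derive _ _ _ X]big_mkcond; apply: is_derive_sum => i.
  by case: ifPn => [/H//|_]; exact: is_derive_cst.
apply/funext => s; rewrite big_mkcond fct_sumE.
by apply: eq_bigr => i _; case: ifP.
Qed.

Lemma is_derive_pair_energy_line (R : realType) (n : nat) (phi dphi : R -> R)
    (m theta v : 'cV[R]_n) (t : R) :
  (forall j k : 'I_n, (j < k)%N ->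
    let x := (t *: v + theta) k 0 - (t *: v + theta) j 0 in
    is_derive x 1 phi (dphi x)) ->
  is_derive t 1 (fun s => pair_energy phi m (s *: v + theta))
    (dpair_energy dphi m (t *: v + theta) v).
Proof.
move=> dP; apply: is_derive_sum_cond => j _; apply: is_derive_sum_cond => k jk.
have gE s : (s *: v + theta) k 0 - (s *: v + theta) j 0
    = s * (v k 0 - v j 0) + (theta k 0 - theta j 0) by rewrite !mxE; ring.
under eq_fun do rewrite gE.
have := dP _ _ jk; rewrite gE /= => dx.
pose g s : R := s * (v k 0 - v j 0) + (theta k 0 - theta j 0).
have dg : is_derive t 1 g (v k 0 - v j 0).
  rewrite /g; apply: is_derive_eq.
  by rewrite !(scaler0, addr0, add0r) /GRing.scale /= mulr1.
have dc := @is_derive1_comp R phi g t _ _ dx dg.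
have := @is_deriveZ _ _ _ _ (m j 0 * m k 0) t 1 _ dc.
by rewrite [_ * dphi _]mulrC.
Qed.

(** The difference quotient at 0 of the restriction to the line is the very quotient that defines
    the derivative along [v]. *)
Lemma is_derive_lineP (R : realType) (V : normedModType R) (f : V -> R)
    (x v : V) (d : R) :
  is_derive (0 : R) (1 : R) (fun s => f (s *: v + x)) d -> is_derive x v f d.
Proof.
move=> [fxv <-]; apply: DeriveDef; first exact/derivable1P.
rewrite /derive; set g1 := fun h => h^-1 *: _; set g2 := fun h => h^-1 *: _.
suff -> : g1 = g2 by [].
apply/funext => h; rewrite /g1 /g2 /=.
by rewrite addr0 scale0r add0r [_%:A]mulr1.
Qed.

(** Pair energies see only the gaps between angles; this convex condition keeps every gap where the
    potentials are differentiable. *)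
Definition arcs (R : realType) (n : nat) (theta : 'cV[R]_n) : Prop :=
  forall j k : 'I_n, (j < k)%N -> 0 < theta k 0 - theta j 0 < 2 * pi.

Lemma K0_arcs (R : realType) (n : nat) (theta : 'cV[R]_n) :
  @K0 R n theta -> arcs theta.
Proof.
move=> [pos incr last] j k jk.
have n_gt0 : (0 < n)%N by apply: leq_ltn_trans (ltn_ord j).
have last_lt : (n.-1 < n)%N by rewrite prednK.
have le_2pi : theta k 0 <= 2 * pi.
  rewrite -(last (Ordinal last_lt)) /= ?prednK //.
  have [kn|kn] := eqVneq (k : nat) n.-1.
    by rewrite (_ : k = Ordinal last_lt) //; exact: val_inj.
  by apply/ltW/incr; have := ltn_ord k; move: kn => /=; lia.
by have := pos j; have := incr _ _ jk; move=> ? ?; apply/andP; split; lra.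
Qed.

Lemma arcs_convex (R : realType) (n : nat) (theta theta' : 'cV[R]_n) (t : R) :
  arcs theta -> arcs theta' -> 0 <= t <= 1 ->
  arcs (t *: (theta' - theta) + theta).
Proof.
move=> A A' /andP[t0 t1] j k jk; rewrite !mxE.
have /andP[a b] := A _ _ jk; have /andP[a' b'] := A' _ _ jk.
have [->|t_neq0] := eqVneq t 0; first by apply/andP; split; lra.
have tp : 0 < t by rewrite lt_neqAle eq_sym t_neq0.
by apply/andP; split; nra.
Qed.

Lemma is_derive_pair_energy (R : realType) (n : nat) (phi dphi : R -> R)
    (m theta v : 'cV[R]_n) :
  (forall x, 0 < x < 2 * pi -> is_derive x 1 phi (dphi x)) -> arcs theta ->
  is_derive theta v (pair_energy phi m) (dpair_energy dphi m theta v).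
Proof.
move=> dP A; apply: is_derive_lineP.
have := @is_derive_pair_energy_line _ _ phi dphi m theta v 0.
by rewrite scale0r add0r; apply => j k jk; apply: dP; exact: A.
Qed.

(** Linearity in [v], through which a vanishing gradient kills the derivative in every direction. *)
Lemma dpair_energy_basis (R : realType) (n : nat) (dphi : R -> R)
    (m theta v : 'cV[R]_n) :
  dpair_energy dphi m theta v
    = \sum_i v i 0 * dpair_energy dphi m theta (delta_mx i 0).
Proof.
under [RHS]eq_bigr do rewrite mulr_sumr; rewrite exchange_big /=.
apply: eq_bigr => j _.
under [RHS]eq_bigr do rewrite mulr_sumr; rewrite exchange_big /=.
apply: eq_bigr => k _.
have coord q : v q 0 = \sum_i v i 0 * (delta_mx i 0 : 'cV[R]_n) q 0.
  rewrite (bigD1 q) //= mxE !eqxx mulr1 big1 ?addr0 // => i iq.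
  by rewrite mxE eq_sym (negbTE iq) mulr0.
rewrite [in LHS](coord k) [in LHS](coord j) -sumrB mulr_suml mulr_sumr.
by apply: eq_bigr => i _; ring.
Qed.

Lemma gradient_pair_energy (R : realType) (n : nat) (phi dphi : R -> R)
    (m theta : 'cV[R]_n) :
  (forall x, 0 < x < 2 * pi -> is_derive x 1 phi (dphi x)) -> arcs theta ->
  gradient (pair_energy phi m) theta
    = \col_i dpair_energy dphi m theta (delta_mx i 0).
Proof.
move=> dP A; apply/matrixP => i j; rewrite !mxE.
by have [_ ->] := is_derive_pair_energy m (delta_mx i 0) dP A.
Qed.

Lemma gradient_eq0_dpair_energy (R : realType) (n : nat) (phi dphi : R -> R)
    (m theta v : 'cV[R]_n) :
  (forall x, 0 < x < 2 * pi -> is_derive x 1 phi (dphi x)) -> arcs theta ->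
  gradient (pair_energy phi m) theta = 0 -> dpair_energy dphi m theta v = 0.
Proof.
move=> dP A; rewrite (gradient_pair_energy m dP A) => /matrixP g0.
rewrite dpair_energy_basis big1 // => i _.
by have := g0 i 0; rewrite !mxE => ->; rewrite mulr0.
Qed.

(** A gap [x] moves to [x + t w] with [w = v_k - v_j], so [dphi] changes in the direction of the
    sign of [w] and each term [w * dphi] can only grow. *)
Lemma dpair_energy_mono (R : realType) (n : nat) (dphi : R -> R)
    (m theta v : 'cV[R]_n) (t : R) :
  (forall x y, 0 < x -> x < y -> y < 2 * pi -> dphi x < dphi y) ->
  pos_vec m -> arcs theta -> arcs (t *: v + theta) -> 0 <= t ->
  dpair_energy dphi m theta v <= dpair_energy dphi m (t *: v + theta) v.
Proof.
move=> dphi_incr m_gt0 A A' t_ge0; apply: ler_sum => j _; apply: ler_sum => k jk.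
rewrite ler_pM2l ?mulr_gt0 //.
have := A _ _ jk; have := A' _ _ jk; rewrite !mxE.
rewrite (_ : _ - _ = theta k 0 - theta j 0 + t * (v k 0 - v j 0)); last by ring.
move: (theta k 0 - _) (v k 0 - _) => x w /andP[a' b'] /andP[a b].
move: t_ge0; rewrite le_eqVlt => /predU1P[<-|t_gt0].
  by rewrite mul0r addr0.
have [w_lt0|w_gt0|->] := ltgtP w 0; last by rewrite !mul0r.
- by rewrite ler_nM2l // ltW // dphi_incr //; nra.
- by rewrite ler_pM2l // ltW // dphi_incr //; nra.
Qed.

(** The difference of the two derivatives is a sum of terms [(y - x) * (dphi y - dphi x)] with
    positive weights. Each is nonnegative and vanishes only for equal gaps [x = y]. *)
Lemma dpair_energy_inj (R : realType) (n : nat) (dphi : R -> R)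
    (m theta theta' : 'cV[R]_n) :
  (forall x y, 0 < x -> x < y -> y < 2 * pi -> dphi x < dphi y) ->
  pos_vec m -> arcs theta -> arcs theta' ->
  dpair_energy dphi m theta (theta' - theta)
    = dpair_energy dphi m theta' (theta' - theta) ->
  forall j k : 'I_n, (j < k)%N ->
    theta' k 0 - theta' j 0 = theta k 0 - theta j 0.
Proof.
move=> dphi_incr m_gt0 A A' /esym/eqP; rewrite -subr_eq0 -sumrB => /eqP eq0.
pose F j k := m j 0 * m k 0 * (((theta' - theta) k 0 - (theta' - theta) j 0) *
  (dphi (theta' k 0 - theta' j 0) - dphi (theta k 0 - theta j 0))).
have sgn (j k : 'I_n) : (j < k)%N -> 0 <= F j k
    /\ (F j k = 0 -> theta' k 0 - theta' j 0 = theta k 0 - theta j 0).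
  move=> jk; rewrite /F; have mm : 0 < m j 0 * m k 0 by rewrite mulr_gt0.
  have := A _ _ jk; have := A' _ _ jk; rewrite !mxE.
  rewrite (_ : _ - (_ - theta j 0)
    = (theta' k 0 - theta' j 0) - (theta k 0 - theta j 0)); last by ring.
  move: (theta k 0 - _) (theta' k 0 - _) => x y /andP[y0 y2] /andP[x0 x2].
  have [xy|yx|->] := ltgtP x y; last by rewrite subrr !mul0r mulr0.
  - have d := dphi_incr _ _ x0 xy y2.
    have /lt0r_neq0/eqP F0 : 0 < m j 0 * m k 0 * ((y - x) * (dphi y - dphi x)).
      by rewrite !mulr_gt0 ?subr_gt0.
    by split=> //; rewrite ltW // !mulr_gt0 ?subr_gt0.
  - have d := dphi_incr _ _ y0 yx x2.
    have F0 : 0 < m j 0 * m k 0 * ((y - x) * (dphi y - dphi x)).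
      by rewrite pmulr_rgt0 // nmulr_rgt0 ?subr_lt0.
    by split=> [|/eqP]; rewrite ?ltW // (gt_eqF F0).
have sum0 : \sum_(j < n) \sum_(k < n | (j < k)%N) F j k = 0.
  rewrite -[RHS]eq0; apply: eq_bigr => j _; rewrite -sumrB.
  by apply: eq_bigr => k _; rewrite /F; ring.
move=> j k jk; apply: (sgn j k jk).2.
have inner (j' : 'I_n) : true -> 0 <= \sum_(k' < n | (j' < k')%N) F j' k'.
  by move=> _; apply: sumr_ge0 => k' /sgn[].
have row0 : \sum_(k' < n | (j < k')%N) F j k' = 0.
  exact: (psumr_eq0P inner sum0 isT).
exact: (psumr_eq0P (fun k' jk' => (sgn j k' jk').1) row0 jk).
Qed.

(** By the mean value theorem on the segment, the change in energy is the derivative at an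
    intermediate point, which is at least the derivative at the start, namely 0. *)
Lemma critical_pair_energy_min (R : realType) (n : nat) (phi dphi : R -> R)
    (m theta theta' : 'cV[R]_n) :
  (forall x, 0 < x < 2 * pi -> is_derive x 1 phi (dphi x)) ->
  (forall x y, 0 < x -> x < y -> y < 2 * pi -> dphi x < dphi y) ->
  pos_vec m -> arcs theta -> arcs theta' ->
  gradient (pair_energy phi m) theta = 0 ->
  pair_energy phi m theta <= pair_energy phi m theta'.
Proof.
move=> dP dphi_incr m_gt0 A A' g0; pose v := theta' - theta.
pose f (t : R) := pair_energy phi m (t *: v + theta).
have At t : 0 <= t <= 1 -> arcs (t *: v + theta) by exact: arcs_convex.
pose f' (t : R) := dpair_energy dphi m (t *: v + theta) v.
have df (t : R) : 0 <= t <= 1 -> is_derive t 1 f (f' t).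
  move=> t01; apply: is_derive_pair_energy_line => j k jk /=.
  by apply: dP; apply: At.
have [t t01||c c01] := @MVT_segment R f f' 0 1 ler01.
- by apply: df; move: t01; rewrite in_itv /= => /andP[? ?]; rewrite !ltW.
- apply: derivable_within_continuous => t; rewrite in_itv /=.
  by move=> /df[].
rewrite subr0 mulr1 /f scale1r scale0r add0r subrK => fE.
rewrite -subr_ge0 fE -(gradient_eq0_dpair_energy v dP A g0).
move: c01; rewrite in_itv /= => c01.
by apply: dpair_energy_mono => //; [exact: At | case/andP: c01].
Qed.

(** Both derivatives along the joining segment vanish, so the gaps agree; the common last angle
    [2 * pi] then excludes a rotation. *)
Lemma critical_pair_energy_uniq (R : realType) (n : nat) (phi dphi : R -> R)
    (m theta theta' : 'cV[R]_n) :
  (forall x, 0 < x < 2 * pi -> is_derive x 1 phi (dphi x)) ->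
  (forall x y, 0 < x -> x < y -> y < 2 * pi -> dphi x < dphi y) ->
  pos_vec m -> @K0 R n theta -> @K0 R n theta' ->
  gradient (pair_energy phi m) theta = 0 ->
  gradient (pair_energy phi m) theta' = 0 -> theta = theta'.
Proof.
move=> dP dphi_incr m_gt0 T T' g0 g0'.
have A := K0_arcs T; have A' := K0_arcs T'.
have eqD := dpair_energy_inj dphi_incr m_gt0 A A' (etrans
  (gradient_eq0_dpair_energy _ dP A g0)
  (esym (gradient_eq0_dpair_energy _ dP A' g0'))).
apply/matrixP => i j; rewrite (ord1 j) {j}.
have n_gt0 : (0 < n)%N by apply: leq_ltn_trans (ltn_ord i).
have last_lt : (n.-1 < n)%N by rewrite prednK.
pose z := Ordinal last_lt.
have zE : theta z 0 = theta' z 0.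
  case: T T' => _ _ lastT [_ _ lastT'].
  by rewrite lastT ?lastT' //= prednK.
have [iz|iz] := eqVneq (i : nat) n.-1.
  by rewrite (_ : i = z) //; exact: val_inj.
have iz' : (i < z)%N by have := ltn_ord i; move: iz => /=; lia.
by have := eqD _ _ iz'; rewrite zE => /addrI/oppr_inj ->.
Qed.

(** * The energies of the problem as pair energies, and the critical point of [fK] *)

Lemma dist_chord (R : realType) (n : nat) (theta : 'cV[R]_n) (j k : 'I_n) :
  Defs.dist theta j k = `|chord (theta k 0 - theta j 0)|.
Proof.
rewrite /Defs.dist /chord -normrN -mulrN -sinN; congr `|2 * sin _|; by field.
Qed.

Lemma U_pair_energy (R : realType) (n : nat) (alpha : R) (m : 'cV[R]_n) :
  U alpha m = pair_energy (power_potential (- alpha)) m.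
Proof.
apply/funext => theta; apply: eq_bigr => j _; apply: eq_bigr => k _.
by rewrite dist_chord /power_potential powRN.
Qed.

Lemma Um2_pair_energy (R : realType) (n : nat) (m : 'cV[R]_n) :
  Um2 m = pair_energy (power_potential 2) m.
Proof.
apply/funext => theta; apply: eq_bigr => j _; apply: eq_bigr => k _.
by rewrite dist_chord /power_potential powR_mulrn.
Qed.

Lemma fK_pair_energy (R : realType) (n : nat) (alpha K : R) (m : 'cV[R]_n) :
  fK alpha K m = pair_energy (mix_potential alpha K) m.
Proof.
apply/funext => theta; rewrite /fK U_pair_energy Um2_pair_energy mulr_sumr.
rewrite -big_split; apply: eq_bigr => j _; rewrite mulr_sumr -big_split.
by apply: eq_bigr => k _; rewrite /mix_potential /=; ring.
Qed.

Lemma gradient_fK_eq0 (R : realType) (n : nat) (alpha K : R)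
    (m theta : 'cV[R]_n) :
  arcs theta -> gradient (U alpha m) theta = 0 -> gradient (Um2 m) theta = 0 ->
  gradient (fK alpha K m) theta = 0.
Proof.
move=> A; rewrite U_pair_energy Um2_pair_energy fK_pair_energy => gU gUm2.
have dpot beta x := @is_derive_power_potential R beta x.
have dmix x := @is_derive_mix_potential R alpha K x.
rewrite (gradient_pair_energy m dmix A); apply/matrixP => i j; rewrite !mxE.
have D1 := gradient_eq0_dpair_energy (delta_mx i 0) (dpot (- alpha)) A gU.
have D2 := gradient_eq0_dpair_energy (delta_mx i 0) (dpot 2) A gUm2.
(* The zero on the right is expanded into the left side of [D1] plus [K^-1] times that of [D2], for
   a termwise comparison. *)
rewrite -[RHS](mulr0 K^-1) -[in RHS]D2 -[RHS]add0r -[in RHS]D1 mulr_sumr.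
rewrite -big_split; apply: eq_bigr => p _; rewrite mulr_sumr -big_split.
by apply: eq_bigr => q _; rewrite /dmix_potential /=; ring.
Qed.

Lemma CC0_fK_critical (R : realType) (n : nat) (alpha K : R)
    (m theta : 'cV[R]_n) :
  CC0 alpha (m, theta) ->
  [/\ pos_vec m, @K0 R n theta & gradient (fK alpha K m) theta = 0].
Proof.
move=> [[m_gt0 T] [gU _ gUm2 _]]; split=> //.
by apply: gradient_fK_eq0 => //; exact: K0_arcs.
Qed.

Lemma theta_of_unique (R : realType) (n : nat) (alpha K : R)
    (m theta : 'cV[R]_n) :
  0 < alpha -> 2 `^ (3 + alpha) / alpha <= K -> pos_vec m ->
  @K0 R n theta -> gradient (fK alpha K m) theta = 0 ->
  theta = theta_of alpha K m.
Proof.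
move=> a0 hK m_gt0 T g0; rewrite /theta_of.
(* As [theta] lies in the set, [xget] cannot have returned its default value. *)
case: xgetP => [theta' _ [T' g0']|/(_ theta)]; last by move=> /(_ (conj T g0)).
move: g0 g0'; rewrite fK_pair_energy.
apply: critical_pair_energy_uniq m_gt0 T T'.
  by move=> x; exact: is_derive_mix_potential.
by move=> x y; exact: dmix_potential_incr.
Qed.

Lemma fK_critical_min (R : realType) (n : nat) (alpha K : R)
    (m theta theta' : 'cV[R]_n) :
  0 < alpha -> 2 `^ (3 + alpha) / alpha <= K -> pos_vec m ->
  @K0 R n theta -> @K0 R n theta' -> gradient (fK alpha K m) theta = 0 ->
  fK alpha K m theta <= fK alpha K m theta'.
Proof.
move=> a0 hK m_gt0 /K0_arcs A /K0_arcs A'; rewrite fK_pair_energy.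
apply: critical_pair_energy_min m_gt0 A A'.
  by move=> x; exact: is_derive_mix_potential.
by move=> x y; exact: dmix_potential_incr.
Qed.

(** * Invariance under relabelling, rotation and reflection *)

Lemma sum_distinct_pairs (R : realType) (n : nat) (F : 'I_n -> 'I_n -> R) :
  (forall j k, F j k = F k j) ->
  \sum_j \sum_(k | k != j) F j k
    = (\sum_(j < n) \sum_(k < n | (j < k)%N) F j k) *+ 2.
Proof.
move=> Fsym; rewrite mulr2n.
rewrite -[X in _ = X + _](_ : \sum_(j < n) \sum_(k < n | (k < j)%N) F j k = _).
  rewrite -big_split; apply: eq_bigr => j _ /=.
  rewrite (bigID (fun k : 'I_n => (k < j)%N)) /=.
  by congr (_ + _); apply: eq_bigl => k; rewrite -val_eqE /=; lia.
rewrite (exchange_big_dep xpredT) //=.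
by apply: eq_bigr => j _; apply: eq_bigr => k _; exact: Fsym.
Qed.

(** A relabelling need not respect [j < k], but it respects [j != k]. Both sides are therefore
    doubled into sums over ordered distinct pairs, which are reindexed directly. *)
Lemma reindex_pairs (R : realType) (n : nat) (s : 'I_n -> 'I_n)
    (F : 'I_n -> 'I_n -> R) :
  injective s -> (forall j k, F j k = F k j) ->
  \sum_(j < n) \sum_(k < n | (j < k)%N) F (s j) (s k)
    = \sum_(j < n) \sum_(k < n | (j < k)%N) F j k.
Proof.
move=> s_inj Fsym; have := sum_distinct_pairs Fsym.
rewrite (reindex_inj s_inj) /=.
under eq_bigr => j _.
  rewrite (reindex_inj s_inj) /=.
  under eq_bigl => k do rewrite (inj_eq s_inj).
  over.
rewrite sum_distinct_pairs; last by move=> *; exact: Fsym.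
by rewrite !mulr2n; lra.
Qed.

(** Such a function of an angle difference depends only on the two points of the circle, not on
    their order or on the choice of angles. *)
Definition arc_potential (R : realType) (phi : R -> R) : Prop :=
  (forall x, phi (- x) = phi x) /\ periodic phi (2 * pi).

Lemma arc_power_potential (R : realType) (beta : R) :
  arc_potential (power_potential beta).
Proof.
split=> x; rewrite /power_potential /chord.
  by rewrite mulNr sinN mulrN normrN.
rewrite (_ : (x + 2 * pi) / 2 = x / 2 + pi); last by field.
by rewrite sinDpi mulrN normrN.
Qed.

(* The action of a rotation (eps = false) or reflection (eps = true) of the
   circle on the angles, followed by the relabelling s; the integer multiples of 2 pi
   bring the angles back into the fundamental domain K0. *)
Definition congruent (R : realType) (n : nat) (eps : bool) (s : 'I_n -> 'I_n)
    (theta theta' : 'cV[R]_n) : Prop :=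
  exists (a : R) (b : 'I_n -> nat), forall i,
    theta' i 0 = (-1) ^+ eps * theta (s i) 0 + a + 2 * pi *+ b i.

Definition relabelled (R : realType) (n : nat) (s : 'I_n -> 'I_n)
    (m m' : 'cV[R]_n) : Prop := forall i, m' i 0 = m (s i) 0.

Lemma periodicMn (R : realType) (phi : R -> R) (T x : R) (b : nat) :
  periodic phi T -> phi (x + T *+ b) = phi x.
Proof.
by move=> per; elim: b => [|b IH]; rewrite ?mulr0n ?addr0 // mulrSr addrA per.
Qed.

Lemma arc_potential_congruent (R : realType) (n : nat) (eps : bool)
    (s : 'I_n -> 'I_n) (phi : R -> R) (theta theta' : 'cV[R]_n) (j k : 'I_n) :
  arc_potential phi -> congruent eps s theta theta' ->
  phi (theta' k 0 - theta' j 0) = phi (theta (s k) 0 - theta (s j) 0).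
Proof.
move=> [ev per] [a [b c]]; rewrite !c.
(* Since [b j] is a natural number, its multiple of the period is added to the argument, where it
   cancels the one subtracted with [theta' j 0]. *)
rewrite -(periodicMn _ (b j) per).
rewrite [X in phi X = _](_ : _ = (-1) ^+ eps * (theta (s k) 0 - theta (s j) 0)
  + 2 * pi *+ b k); last by rewrite mulrBr; move: ((-1) ^+ _ * _) => u; ring.
rewrite periodicMn //; case: eps {c}; last by rewrite expr0 mul1r.
by rewrite expr1 mulN1r ev.
Qed.

Lemma pair_energy_congruent (R : realType) (n : nat) (eps : bool)
    (s : 'I_n -> 'I_n) (phi : R -> R) (m m' theta theta' : 'cV[R]_n) :
  injective s -> arc_potential phi -> relabelled s m m' ->
  congruent eps s theta theta' ->
  pair_energy phi m' theta' = pair_energy phi m theta.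
Proof.
move=> s_inj phiP mm' tt'; rewrite /pair_energy.
rewrite -(reindex_pairs s_inj
  (F := fun j k => m j 0 * m k 0 * phi (theta k 0 - theta j 0))).
  apply: eq_bigr => j _; apply: eq_bigr => k _.
  by rewrite !mm' (arc_potential_congruent _ _ phiP tt').
by move=> j k; rewrite -(phiP.1 (_ - _)) opprB [m j 0 * _]mulrC.
Qed.

Lemma delta_relabelled (R : realType) (n : nat) (s : 'I_n -> 'I_n) (i : 'I_n) :
  injective s -> relabelled s (delta_mx (s i) 0 : 'cV[R]_n) (delta_mx i 0).
Proof. by move=> s_inj j; rewrite !mxE (inj_eq s_inj). Qed.

(** The difference quotients coincide for every [h], hence so do their limits. This transports
    partial derivatives between configurations. *)
Lemma eq_derive (R : realType) (V V' : normedModType R) (f : V -> R)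
    (g : V' -> R) (x v : V) (y w : V') :
  (forall h : R, f (h *: v + x) = g (h *: w + y)) -> 'D_v f x = 'D_w g y.
Proof.
move=> fg; have := fg 0; rewrite !scale0r !add0r => fxgy.
rewrite /derive; set g1 := fun h => h^-1 *: _; set g2 := fun h => h^-1 *: _.
suff -> : g1 = g2 by [].
by apply/funext => h; rewrite /g1 /g2 /= fxgy fg.
Qed.

Lemma gradient_angles_congruent (R : realType) (n : nat) (eps : bool)
    (s : 'I_n -> 'I_n) (phi dphi : R -> R) (m m' theta theta' : 'cV[R]_n) :
  (forall x, 0 < x < 2 * pi -> is_derive x 1 phi (dphi x)) -> arcs theta ->
  injective s -> arc_potential phi -> relabelled s m m' ->
  congruent eps s theta theta' ->
  gradient (pair_energy phi m) theta = 0 ->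
  gradient (pair_energy phi m') theta' = 0.
Proof.
move=> dP A s_inj phiP mm' [a [b c]] g0.
apply/matrixP => i j; rewrite !mxE.
(* Moving the new angle [i] by [h] amounts to moving the old angle [s i] by [h], with opposite sign
   for a reflection. *)
pose w : 'cV[R]_n := (-1) ^+ eps *: delta_mx (s i) 0.
rewrite (_ : 'D__ _ _ = 'D_w (pair_energy phi m) theta).
  have [_ ->] := is_derive_pair_energy m w dP A.
  exact: gradient_eq0_dpair_energy dP A g0.
apply: eq_derive => h; apply: (pair_energy_congruent (eps := eps)) mm' _ => //.
exists a, b => k; have := delta_relabelled R i s_inj k; rewrite !mxE => ->.
by rewrite c [_ * (h * _ + _)]mulrDr [h * (_ * _)]mulrCA signrMK !addrA.
Qed.

(** The gradient is merely permuted by [s], and a constant vector is unchanged by a permutation. *)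
Lemma gradient_masses_congruent (R : realType) (n : nat) (eps : bool)
    (s : 'I_n -> 'I_n) (phi : R -> R) (m m' theta theta' : 'cV[R]_n) (c : R) :
  injective s -> arc_potential phi -> relabelled s m m' ->
  congruent eps s theta theta' ->
  gradient (fun u => pair_energy phi u theta) m = const_mx c ->
  gradient (fun u => pair_energy phi u theta') m' = const_mx c.
Proof.
move=> s_inj phiP mm' tt' /matrixP g0.
apply/matrixP => i j; have := g0 (s i) j; rewrite !mxE => <-.
apply: eq_derive => h; apply: pair_energy_congruent phiP _ tt' => // k.
by have := delta_relabelled R i s_inj k; rewrite !mxE => ->; rewrite mm'.
Qed.

(** The energies and the total mass are invariant, so the constants in the mass equations persist.
    Membership of [theta'] in [K0] is assumed because a congruence alone does not control the order
    of the angles. *)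
Lemma CC0_congruent (R : realType) (n : nat) (eps : bool) (s : 'I_n -> 'I_n)
    (alpha : R) (m m' theta theta' : 'cV[R]_n) :
  injective s -> relabelled s m m' -> congruent eps s theta theta' ->
  @K0 R n theta' -> CC0 alpha (m, theta) ->
  [/\ CC0 alpha (m', theta'), U alpha m' theta' = U alpha m theta &
      Um2 m' theta' = Um2 m theta].
Proof.
move=> s_inj mm' tt' T' [[m_gt0 T] [gUt gUm gUm2t gUm2m]].
have phiP beta := @arc_power_potential R beta.
have A := K0_arcs T.
have dpot beta x := @is_derive_power_potential R beta x.
have UE : U alpha m' theta' = U alpha m theta.
  by rewrite !U_pair_energy; apply: pair_energy_congruent tt'.
have Um2E : Um2 m' theta' = Um2 m theta.
  by rewrite !Um2_pair_energy; apply: pair_energy_congruent tt'.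
have ME : total_mass m' = total_mass m.
  rewrite /total_mass [RHS](reindex_inj s_inj).
  by apply: eq_bigr => i _; exact: mm'.
have UmE t : (fun u => U alpha u t)
    = (fun u => pair_energy (power_potential (- alpha)) u t).
  by apply/funext => u; rewrite U_pair_energy.
have Um2mE t : (fun u => Um2 u t)
    = (fun u : 'cV[R]_n => pair_energy (power_potential 2) u t).
  by apply/funext => u; rewrite Um2_pair_energy.
split=> //; split; first by split=> // j; rewrite mm'.
rewrite UE ME; split.
- move: gUt; rewrite !U_pair_energy.
  exact: gradient_angles_congruent (dpot _) A s_inj (phiP _) mm' tt'.
- move: gUm; rewrite !UmE.
  exact: gradient_masses_congruent s_inj (phiP _) mm' tt'.
- move: gUm2t; rewrite !Um2_pair_energy.
  exact: gradient_angles_congruent (dpot _) A s_inj (phiP _) mm' tt'.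
- move: gUm2m; rewrite !Um2mE.
  exact: gradient_masses_congruent s_inj (phiP _) mm' tt'.
Qed.

(** * The dihedral generators and their action on [K0] *)

Lemma sum_pick (R : realType) (n : nat) (q : 'I_n) (x : 'I_n -> R) :
  \sum_(j < n) (j == q :> nat)%:R * x j = x q.
Proof.
rewrite (bigD1 q) //= eqxx mul1r big1 ?addr0 // => j jq.
by rewrite (_ : (j == q :> nat) = false) ?mul0r //; apply: negbTE.
Qed.

Lemma reflect_subproof (n : nat) (i : 'I_n) :
  ((if i.+1 < n then n - i.+2 else i) < n)%N.
Proof. by have := ltn_ord i; case: ifP; lia. Qed.

(** In one-based indices this is [k -> n - k] for [k < n], with [n] fixed; the zero-based shift
    turns [n - k] into [n - i.+2]. *)
Definition reflect_ord (n : nat) (i : 'I_n) : 'I_n :=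
  Ordinal (reflect_subproof i).

Lemma reflect_ord_inj (n : nat) : injective (@reflect_ord n).
Proof.
move=> i j /(congr1 val) /= ij; apply: val_inj => /=.
by move: ij; have := ltn_ord i; have := ltn_ord j; do 2! case: ifP; lia.
Qed.

Lemma val_ordS (n : nat) (i : 'I_n) :
  ordS i = (if (i.+1 < n)%N then i.+1 else 0%N) :> nat.
Proof.
rewrite /=; have := ltn_ord i; case: ifP => lt_n ?; first by rewrite modn_small.
by rewrite (_ : i.+1 = n) ?modnn //; lia.
Qed.

Lemma P_mx_relabelled (R : realType) (n : nat) (v : 'cV[R]_n) :
  relabelled (@ordS n) v (P_mx R n *m v).
Proof.
move=> i; rewrite mxE -(sum_pick (ordS i) (fun j => v j 0)).
by apply: eq_bigr => j _; rewrite mxE val_ordS.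
Qed.

Lemma S_mx_relabelled (R : realType) (n : nat) (v : 'cV[R]_n) :
  relabelled (@reflect_ord n) v (S_mx R n *m v).
Proof.
move=> i; rewrite mxE -(sum_pick (reflect_ord i) (fun j => v j 0)).
by apply: eq_bigr => j _; rewrite mxE.
Qed.

Lemma Phat_mxE (R : realType) (n : nat) (v : 'cV[R]_n) (i z : 'I_n) :
  z = 0%N :> nat ->
  (Phat_mx R n *m v) i 0
    = if (i.+1 < n)%N then v (ordS i) 0 - v z 0 else v i 0.
Proof.
move=> z0; rewrite mxE; under eq_bigr do rewrite mxE.
case: ifP => i_lt; last exact: (sum_pick i (fun j => v j 0)).
under eq_bigr do rewrite mulrBl.
rewrite sumrB -(sum_pick (ordS i) (fun j => v j 0)) val_ordS i_lt.
by rewrite -(sum_pick z (fun j => v j 0)) z0.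
Qed.

Lemma Shat_mxE (R : realType) (n : nat) (v : 'cV[R]_n) (i z : 'I_n) :
  z.+1 = n ->
  (Shat_mx R n *m v) i 0
    = if (i.+1 < n)%N then v z 0 - v (reflect_ord i) 0 else v i 0.
Proof.
move=> zn; rewrite mxE; under eq_bigr do rewrite mxE.
case: ifP => i_lt; last exact: (sum_pick i (fun j => v j 0)).
under eq_bigr do rewrite mulrBl.
rewrite sumrB -(sum_pick (reflect_ord i) (fun j => v j 0)) /= i_lt.
rewrite -(sum_pick z (fun j => v j 0)); congr (_ - _).
by apply: eq_bigr => j _; rewrite -[in RHS]eqSS zn.
Qed.

Lemma Phat_congruent (R : realType) (n : nat) (theta : 'cV[R]_n) :
  @K0 R n theta -> congruent false (@ordS n) theta (Phat_mx R n *m theta).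
Proof.
move=> [_ _ last]; case: n theta last => [|n] theta last.
  by exists 0, (fun _ => 0%N) => -[].
(* Rotation by minus the first angle. The last row receives the first point, now at angle 0, and
   needs one full turn to reach [2 * pi]. *)
exists (- theta ord0 0), (fun i => (i.+1 == n.+1 : nat)) => i.
rewrite (Phat_mxE _ _ (z := ord0)) // expr0 mul1r.
case: ltnP => i_n; first by rewrite (ltn_eqF i_n) mulr0n addr0.
have iE : i.+1 = n.+1 by have := ltn_ord i; lia.
rewrite (_ : ordS i = ord0); last by apply: ord_inj; rewrite val_ordS iE ltnn.
by rewrite subrr add0r (last _ iE) iE eqxx mulr1n.
Qed.

Lemma Shat_congruent (R : realType) (n : nat) (theta : 'cV[R]_n) :
  @K0 R n theta -> congruent true (@reflect_ord n) theta (Shat_mx R n *m theta).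
Proof.
move=> [_ _ last]; case: n theta last => [|n] theta last.
  by exists 0, (fun _ => 0%N) => -[].
(* Reflection followed by a shift by the last angle. The last point lands at 0 and again needs one
   full turn. *)
exists (theta ord_max 0), (fun i => (i.+1 == n.+1 : nat)) => i.
rewrite (Shat_mxE _ _ (z := ord_max)) // expr1 mulN1r.
case: ltnP => i_n; first by rewrite (ltn_eqF i_n) mulr0n addr0 addrC.
have iE : i.+1 = n.+1 by have := ltn_ord i; lia.
rewrite (_ : reflect_ord i = i); last by apply: val_inj; rewrite /= iE ltnn.
rewrite (_ : ord_max = i); last by apply: val_inj => /=; lia.
by rewrite addNr add0r (last _ iE) iE eqxx mulr1n.
Qed.

Lemma Phat_K0 (R : realType) (n : nat) (theta : 'cV[R]_n) :
  @K0 R n theta -> @K0 R n (Phat_mx R n *m theta).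
Proof.
case: n theta => [|n] theta T; first by split=> -[].
have [pos incr last] := T; have E i := @Phat_mxE R n.+1 theta i ord0 erefl.
split=> [i|i j ij|i iE].
- rewrite E; case: ifP => // i_lt; rewrite subr_gt0 incr // val_ordS i_lt.
  exact: ltn0Sn.
- have i_lt : (i.+1 < n.+1)%N by have := ltn_ord j; lia.
  rewrite !E i_lt; case: ifP => j_lt.
    by rewrite ltrD2r incr // !val_ordS i_lt j_lt.
  have jE : j.+1 = n.+1 by have := ltn_ord j; lia.
  (* The last entry is not lowered by the first angle, so positivity of that angle gives strictness
     even when [ordS i] is already the last index. *)
  have [iSj|] := eqVneq (ordS i : nat) j.
    by rewrite (val_inj iSj) ltrBlDr ltrDl.
  rewrite val_ordS i_lt => iSj.
  have : theta (ordS i) 0 < theta j 0.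
    by apply: incr; rewrite val_ordS i_lt; move: iSj; lia.
  by have := pos ord0; lra.
- by rewrite E iE ltnn last.
Qed.

Lemma Shat_K0 (R : realType) (n : nat) (theta : 'cV[R]_n) :
  @K0 R n theta -> @K0 R n (Shat_mx R n *m theta).
Proof.
case: n theta => [|n] theta T; first by split=> -[].
have [pos incr last] := T.
have E i := @Shat_mxE R n.+1 theta i ord_max erefl.
split=> [i|i j ij|i iE].
- rewrite E; case: ifP => // i_lt; rewrite subr_gt0 incr //= i_lt; lia.
- have i_lt : (i.+1 < n.+1)%N by have := ltn_ord j; lia.
  rewrite !E i_lt; case: ifP => j_lt.
    by rewrite ltrD2l ltrN2 incr //= i_lt j_lt; lia.
  have jE : j.+1 = n.+1 by have := ltn_ord j; lia.
  rewrite (last _ jE) (last ord_max) //.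
  by have := pos (reflect_ord i); lra.
- by rewrite E iE ltnn last.
Qed.

(** Induction on the exponents, powers of [S_mx] first. The hatted matrices are shown to be
    congruences only on [K0], so each step uses that the preceding configuration is still in
    [K0]. *)
Lemma CC0_dihedral (R : realType) (n : nat) (alpha : R) (m theta : 'cV[R]_n)
    (h l : nat) :
  CC0 alpha (m, theta) ->
  let m' := P_mx R n ^+ h *m S_mx R n ^+ l *m m in
  let theta' := hat_mx R n h l *m theta in
  [/\ CC0 alpha (m', theta'), U alpha m' theta' = U alpha m theta &
      Um2 m' theta' = Um2 m theta].
Proof.
move=> CC /=; rewrite /hat_mx.
have step (A Ahat : 'M[R]_n) (eps : bool) (s : 'I_n -> 'I_n) :
    injective s -> (forall v, relabelled s v (A *m v)) ->
    (forall t, @K0 R n t ->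
      congruent eps s t (Ahat *m t) /\ @K0 R n (Ahat *m t)) ->
    forall (k : nat) (u t : 'cV[R]_n), CC0 alpha (u, t) ->
    [/\ CC0 alpha (A ^+ k *m u, Ahat ^+ k *m t),
        U alpha (A ^+ k *m u) (Ahat ^+ k *m t) = U alpha u t &
        Um2 (A ^+ k *m u) (Ahat ^+ k *m t) = Um2 u t].
  move=> s_inj relA hatA; elim=> [|k IH] u t CCut.
    by rewrite !expr0 !mul1mx.
  have [CCk <- <-] := IH _ _ CCut; rewrite !exprS -!mulmxA.
  have [_ Tk] := CCk.1.
  have [tt' Tk'] := hatA _ Tk.
  exact: CC0_congruent s_inj (relA _) tt' Tk' CCk.
have [CCS <- <-] := step _ _ _ _ (@reflect_ord_inj n) (@S_mx_relabelled R n)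
  (fun t T => conj (Shat_congruent T) (Shat_K0 T)) l _ _ CC.
rewrite -!mulmxA.
exact: step (@ordS_inj n) (@P_mx_relabelled R n)
  (fun t T => conj (Phat_congruent T) (Phat_K0 T)) h _ _ CCS.
Qed.

(** The conclusion holds for every factorization of [g] into powers of the generators;
    [dihedral_normal_form] shows that each [g] has one. *)
Theorem lemma3p1 (R : realType) (n : nat) (alpha K : R) (m : 'cV[R]_n)
    (n_ge2 : (2 <= n)%N) (alpha_gt0 : 0 < alpha)
    (K_ge : 2 `^ (3 + alpha) / alpha <= K)
    (m_pos : pos_vec m)
    (m_CC0 : CC0 alpha (m, theta_of alpha K m))
    (g : 'M[R]_n) (g_dihedral : dihedral g)
    (h l : nat) (g_def : g = P_mx R n ^+ h *m S_mx R n ^+ l) :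
  let theta_m := theta_of alpha K m in
  let ghat := hat_mx R n h l in
  [/\ CC0 alpha (g *m m, ghat *m theta_m),
      [/\ fK alpha K m theta_m = fK alpha K (g *m m) (ghat *m theta_m),
          fK alpha K (g *m m) (ghat *m theta_m)
            <= fK alpha K (g *m m) theta_m &
          ghat *m theta_m = theta_of alpha K (g *m m)] &
      m = g *m m -> theta_m = ghat *m theta_m].
Proof.
move=> theta_m ghat.
have [] := CC0_dihedral h l m_CC0; rewrite -g_def -/theta_m -/ghat => CC UE Um2E.
have [gm_pos T crit] := CC0_fK_critical K CC.
have thetaE : ghat *m theta_m = theta_of alpha K (g *m m).
  exact: theta_of_unique gm_pos T crit.
split=> //; last by move=> gm; rewrite thetaE -gm.
split=> //; first by rewrite /fK UE Um2E.
(* The minimum of the energy for [g *m m] is at [ghat *m theta_m]; [theta_m] is a competitor because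
   it lies in [K0]. *)
by apply: fK_critical_min => //; case: m_CC0 => -[].
Qed.
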